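(* Let $\{y_k\}$ be the random sequence generated by the PASKM algorithm. Take $0 \leq 1-\alpha < 1$, $0 \le \omega < 1$, $0 < \delta < \frac{2(1-\omega+\alpha\omega)}{1+2\omega-2\alpha\omega}$ and $\alpha\gamma = \alpha\delta + \omega\delta(1-\alpha)$. Define $\bar{y}_k = \frac{1}{k}\sum_{l=1}^{k} y_l$. Then $$\mathbb{E}[f(\bar{y}_k)] \leq \frac{(1-\omega+\alpha\omega)^2\, d(y_0,P)^2 + 2\delta(\delta-2+3\omega-3\alpha\omega+\delta\omega-\delta\alpha\omega) f(y_0)}{2\delta k(2-2\omega+2\alpha\omega-2\delta\omega+2\delta\alpha\omega-\delta)}.$$
   Context: Linear feasibility problem $Ax \leq b$ with $A \in \mathbb{R}^{m\times n}$, $b \in \mathbb{R}^m$, assumed consistent, with rows $a_i^T$ normalized ($\|a_i\|=1$). $P = \{x : Ax \leq b\}$, $\mathcal{P}(x)$ the Euclidean projection onto $P$, $d(x,P) = \|x-\mathcal{P}(x)\|$. Sampling: at each iteration a set $\tau$ of $\beta$ rows is chosen uniformly at random among all $\binom{m}{\beta}$ subsets and $i^* = \arg\max_{i\in\tau}(a_i^Ty-b_i)^+$ for the current point $y$; $\mathbb{E}_{\mathbb{S}}$ denotes expectation over this sampling. $f(x) = \mathbb{E}_{\mathbb{S}}\big[\tfrac12|(a_{i^*}^Tx-b_{i^*})^+|^2\big]$. PASKM algorithm: $v_0 = x_0$ (so $y_0 = x_0 = v_0$); for $k\ge0$: $y_k = \alpha v_k + (1-\alpha)x_k$; sample and pick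 $i^*$ at $y_k$; $x_{k+1} = y_k - \delta(a_{i^*}^Ty_k-b_{i^*})^+a_{i^*}$; $v_{k+1} = \omega v_k + (1-\omega)y_k - \gamma(a_{i^*}^Ty_k-b_{i^*})^+a_{i^*}$. *)

(* Defs.v *)
From HB Require Import structures.
From mathcomp Require Import all_boot all_order all_algebra.
From mathcomp Require Import classical_sets reals.
Set Implicit Arguments. Unset Strict Implicit. Unset Printing Implicit Defensive.
Import Order.TTheory GRing.Theory Num.Theory.
Local Open Scope ring_scope.
Local Open Scope classical_set_scope.

Section PASKM.
Variables (R : realType) (m n : nat) (A : 'M[R]_(m, n)) (b : 'I_m -> R).

Definition dotr (i : 'I_m) (y : 'rV[R]_n) : R := \sum_(j < n) A i j * y 0 j.

Definition resid (i : 'I_m) (y : 'rV[R]_n) : R := Num.max (dotr i y - b i) 0.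

Definition sqnorm (x : 'rV[R]_n) : R := \sum_(j < n) x 0 j ^+ 2.

Definition feas : set 'rV[R]_n := [set x | forall i, dotr i x <= b i].

Definition dist2 (x : 'rV[R]_n) : R := inf [set sqnorm (x - p) | p in feas].

(* sel tau y is the greedy index i* = argmax_{i in tau} (a_i^T y - b_i)^+
   (any tie-breaking rule). *)
Definition greedy_rule (beta : nat) (sel : {set 'I_m} -> 'rV[R]_n -> 'I_m) :=
  forall (tau : {set 'I_m}) (y : 'rV[R]_n), #|tau| = beta ->
    sel tau y \in tau /\ (forall i, i \in tau -> resid i y <= resid (sel tau y) y).

(* f(x) = E_S [ 1/2 |(a_{i*}^T x - b_{i*})^+|^2 ], tau uniform among the
   'C(m, beta) subsets of size beta, i* chosen at x. *)
Definition fobj (beta : nat) (sel : {set 'I_m} -> 'rV[R]_n -> 'I_m) (x : 'rV[R]_n) : R :=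
  (\sum_(tau : {set 'I_m} | #|tau| == beta) (resid (sel tau x) x ^+ 2 / 2))
    / ('C(m, beta))%:R.

Variables (alpha omega delta gamma : R) (sel : {set 'I_m} -> 'rV[R]_n -> 'I_m).

Fixpoint pstate (s : nat -> {set 'I_m}) (x0 : 'rV[R]_n) (l : nat)
  : 'rV[R]_n * 'rV[R]_n :=
  match l with
  | 0 => (x0, x0)
  | l'.+1 =>
      let: (x, v) := pstate s x0 l' in
      let y := alpha *: v + (1 - alpha) *: x in
      let i := sel (s l') y in
      let r := resid i y in
      (y - (delta * r) *: row i A,
       omega *: v + (1 - omega) *: y - (gamma * r) *: row i A)
  end.

Definition yit (s : nat -> {set 'I_m}) (x0 : 'rV[R]_n) (l : nat) : 'rV[R]_n :=
  let: (x, v) := pstate s x0 l in alpha *: v + (1 - alpha) *: x.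

Definition ybar (s : nat -> {set 'I_m}) (x0 : 'rV[R]_n) (k : nat) : 'rV[R]_n :=
  (k%:R)^-1 *: \sum_(1 <= l < k.+1) yit s x0 l.

Definition samples (k : nat) (w : {ffun 'I_k -> {set 'I_m}}) (l : nat) : {set 'I_m} :=
  if (insub l : option 'I_k) is Some j then w j else finset.set0.

(* E[f(ybar_k)]: expectation over i.i.d. uniform samples tau_0..tau_{k-1}
   (each uniform among the 'C(m,beta) subsets of size beta). *)
Definition exp_f_ybar (beta k : nat) (x0 : 'rV[R]_n) : R :=
  (\sum_(w : {ffun 'I_k -> {set 'I_m}} | [forall j, #|w j| == beta])
      fobj beta sel (ybar (samples w) x0 k))
    / (('C(m, beta) ^ k)%N)%:R.

End PASKM.

(* Main.v *)
Require Import Defs.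
From mathcomp Require Import all_boot all_order all_algebra.
From mathcomp Require Import boolp classical_sets reals.
From mathcomp Require Import ring lra.
Import Order.TTheory GRing.Theory Num.Theory.
Local Open Scope ring_scope.

(** With [w = omega * (1 - alpha)], the vector [Z = (1 - w - alpha) x + alpha v]
    moves by plain subgradient steps, [Z' = Z - delta r a_i], and
    [Z - (1 - w) y = w (y - x)] where [x] is a projection step from the previous
    [y]. Expanding [|Z' - (1 - w) p|^2] for a feasible [p] and using the
    subgradient inequality of [f] between consecutive [y]'s shows that
    [|Z - (1 - w) p|^2] plus suitable multiples of [f(y_{l-1})], [r_{l-1}^2] and
    [\sum_l f(y_l)] is a supermartingale. Jensen's inequality concludes. *)

(** * Averages over samples and over sample paths *)

Section Averages.
Set Implicit Arguments.
Unset Strict Implicit.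
Variables (R : realType) (m beta : nat).
Hypothesis beta_le : (beta <= m)%N.
Implicit Types (F G : {set 'I_m} -> R) (s : nat -> {set 'I_m}).

Definition avg F : R :=
  (\sum_(tau : {set 'I_m} | #|tau| == beta) F tau) / ('C(m, beta))%:R.

(** [Phi] takes infinite sequences, filled by [samples] with the empty set from index [k] on, so
    that all horizons share one type of functionals. *)
Definition path_avg k (Phi : (nat -> {set 'I_m}) -> R) : R :=
  (\sum_(w : {ffun 'I_k -> {set 'I_m}} | [forall j, #|w j| == beta])
      Phi (samples w)) / (('C(m, beta) ^ k)%N)%:R.

Definition set_sample s k tau : nat -> {set 'I_m} :=
  fun l => if l == k then tau else s l.

Lemma bin_gt0R : 0 < ('C(m, beta))%:R :> R.
Proof. by rewrite ltr0n bin_gt0. Qed.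

Lemma le_avg F G : (forall tau : {set 'I_m}, #|tau| = beta -> F tau <= G tau) ->
  avg F <= avg G.
Proof.
move=> leFG; rewrite /avg ler_wpM2r ?invr_ge0 ?(ltW bin_gt0R) //.
by apply: ler_sum => tau /eqP /leFG.
Qed.

Lemma avgD F G : avg (fun tau => F tau + G tau) = avg F + avg G.
Proof. by rewrite /avg big_split mulrDl. Qed.

Lemma avgZ c F : avg (fun tau => c * F tau) = c * avg F.
Proof. by rewrite /avg -mulr_sumr mulrA. Qed.

Lemma avg_cst c : avg (fun=> c) = c.
Proof.
rewrite /avg sumr_const.
have -> : #|[pred tau : {set 'I_m} | #|tau| == beta]| = 'C(m, beta).
  by rewrite -[in RHS](card_ord m) -card_draws cardsE.
by rewrite -[c *+ _]mulr_natr mulfK // gt_eqF ?bin_gt0R.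
Qed.

Lemma le_path_avg k Phi Psi : (forall s, Phi s <= Psi s) ->
  path_avg k Phi <= path_avg k Psi.
Proof.
move=> le; rewrite /path_avg ler_wpM2r ?invr_ge0 ?ler0n //.
exact: ler_sum.
Qed.

Lemma path_avgZ k c Phi :
  path_avg k (fun s => c * Phi s) = c * path_avg k Phi.
Proof. by rewrite /path_avg -mulr_sumr mulrA. Qed.

Lemma path_avg0 Phi : path_avg 0 Phi = Phi (fun=> finset.set0).
Proof.
rewrite /path_avg expn0 divr1.
have e0 (w : {ffun 'I_0 -> {set 'I_m}}) : samples w = fun=> finset.set0.
  by apply/funext => l; rewrite /samples; case: insubP.
under eq_bigr do rewrite e0.
rewrite (eq_bigl predT) => [|w]; last by apply/forallP; case.
by rewrite sumr_const card_ffun card_ord expn0.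
Qed.

(** Fubini: a path of length [k.+1] is a path of length [k] followed by an independent last
    sample. *)
Lemma path_avgS k Phi :
  path_avg k.+1 Phi =
  path_avg k (fun s => avg (fun tau => Phi (set_sample s k tau))).
Proof.
pose ext (p : {ffun 'I_k -> {set 'I_m}} * {set 'I_m}) :
    {ffun 'I_k.+1 -> {set 'I_m}} :=
  [ffun j => if unlift ord_max j is Some i then p.1 i else p.2].
pose res (w : {ffun 'I_k.+1 -> {set 'I_m}}) :=
  ([ffun i => w (lift ord_max i)] : {ffun 'I_k -> {set 'I_m}}, w ord_max).
have extK : cancel ext res.
  case=> w tau; congr pair; last by rewrite ffunE unlift_none.
  by apply/ffunP => i; rewrite !ffunE liftK.
have resK : cancel res ext.
  by move=> w; apply/ffunP => j; rewrite ffunE; case: unliftP => [i|] -> //=;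
    rewrite ffunE.
(* Beyond index [k] the two sequences agree because both take the default empty set. *)
have samplesE p : samples (ext p) = set_sample (samples p.1) k p.2.
  apply/funext => l; rewrite /samples /set_sample.
  case: insubP => [j _ <-|]; last first.
    rewrite -leqNgt => ltkl; rewrite gtn_eqF //.
    by case: insubP => // i; rewrite ltnNge ltnW.
  rewrite ffunE; case: unliftP => [i ->|->]; last by rewrite eqxx.
  have -> : val (lift ord_max i) = i by exact: lift_max.
  rewrite ltn_eqF //.
  by case: insubP => [i' _ /val_inj -> //|]; rewrite ltn_ord.
rewrite /path_avg (reindex ext) /=; last by exists res => ? _.
rewrite /avg -mulr_suml -mulrA -invfM -natrM -expnS pair_big_dep /=.
have extP p : [forall j, #|ext p j| == beta] =
    [forall j, #|p.1 j| == beta] && (#|p.2| == beta).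
  apply/forallP/andP => [cardp|[/forallP card1 card2] j].
    split; last by have := cardp ord_max; rewrite ffunE unlift_none.
    by apply/forallP => i; have := cardp (lift ord_max i); rewrite ffunE liftK.
  by rewrite ffunE; case: unlift.
by congr (_ / _); apply: eq_big => [p|p _]; rewrite ?extP // samplesE.
Qed.

End Averages.

(** * Residuals and the objective *)

Section Objective.
Set Implicit Arguments.
Unset Strict Implicit.
Variables (R : realType) (m n : nat) (A : 'M[R]_(m, n)) (b : 'I_m -> R).
Variables (beta : nat) (sel : {set 'I_m} -> 'rV[R]_n -> 'I_m).
Hypothesis row_norm : forall i : 'I_m, \sum_(j < n) A i j ^+ 2 = 1.
Hypothesis beta_le : (beta <= m)%N.
Hypothesis sel_greedy : greedy_rule A b beta sel.
Implicit Types (x y z p : 'rV[R]_n) (tau : {set 'I_m}).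

Local Notation dot := (dotr A).
Local Notation res := (resid A b).
Local Notation f := (fobj A b beta sel).

Lemma dotrD i x y : dot i (x + y) = dot i x + dot i y.
Proof. by rewrite -big_split; apply: eq_bigr => j _; rewrite mxE mulrDr. Qed.

Lemma dotrZ i c x : dot i (c *: x) = c * dot i x.
Proof. by rewrite mulr_sumr; apply: eq_bigr => j _; rewrite mxE mulrCA. Qed.

Lemma dotrB i x y : dot i (x - y) = dot i x - dot i y.
Proof. by rewrite dotrD -scaleN1r dotrZ mulN1r. Qed.

Lemma dotr_sum i (r : seq nat) (F : nat -> 'rV[R]_n) :
  dot i (\sum_(l <- r) F l) = \sum_(l <- r) dot i (F l).
Proof.
apply: (big_morph (dot i)) => [x y|]; first exact: dotrD.
(* Writing the zero vector as [0 *: 0] lets [dotrZ] evaluate it. *)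
by rewrite -(scale0r 0) dotrZ mul0r.
Qed.

Lemma sqnorm_ge0 x : 0 <= sqnorm x.
Proof. by apply: sumr_ge0 => j _; rewrite sqr_ge0. Qed.

Lemma sqnormZ c x : sqnorm (c *: x) = c ^+ 2 * sqnorm x.
Proof. by rewrite mulr_sumr; apply: eq_bigr => j _; rewrite mxE exprMn. Qed.

Lemma sqnorm_sub_row i c x :
  sqnorm (x - c *: row i A) = sqnorm x - 2 * c * dot i x + c ^+ 2.
Proof.
have -> : c ^+ 2 = c ^+ 2 * \sum_(j < n) A i j ^+ 2 by rewrite row_norm mulr1.
rewrite /sqnorm /dotr !mulr_sumr -sumrB -big_split.
by apply: eq_bigr => j _; rewrite !mxE /=; ring.
Qed.

(** Expand [|r a_i + r' a_i'|^2 >= 0] with unit rows. This controls the product of two consecutive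
    steps. *)
Lemma mul_dot_row_le i i' (r r' : R) :
  - (r * r' * dot i (row i' A)) <= (r ^+ 2 + r' ^+ 2) / 2.
Proof.
have : 0 <= \sum_(j < n) (r * A i j + r' * A i' j) ^+ 2.
  by apply: sumr_ge0 => j _; rewrite sqr_ge0.
have -> : \sum_(j < n) (r * A i j + r' * A i' j) ^+ 2 =
    r ^+ 2 * (\sum_(j < n) A i j ^+ 2) + r' ^+ 2 * (\sum_(j < n) A i' j ^+ 2)
    + 2 * r * r' * dot i (row i' A).
  rewrite /dotr !mulr_sumr -!big_split.
  by apply: eq_bigr => j _; rewrite !mxE /=; ring.
rewrite !row_norm; lra.
Qed.

Lemma resid_ge0 i y : 0 <= res i y.
Proof. by rewrite /resid le_max lexx orbT. Qed.

(** Tangent inequality of the convex function [u -> max(u, 0)^2 / 2], whose derivative is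
    [max(u, 0)]. *)
Lemma resid_subgrad i y z :
  res i y ^+ 2 / 2 + res i y * dot i (z - y) <= res i z ^+ 2 / 2.
Proof.
rewrite dotrB /resid.
have -> : dot i z - dot i y = (dot i z - b i) - (dot i y - b i) by ring.
move: (dot i y - b i) (dot i z - b i) => u v.
have := sqr_ge0 (u - v); have := sqr_ge0 u; have := sqr_ge0 v.
case: (leP u 0) => hu; case: (leP v 0) => hv; rewrite ?expr0n /=; try lra.
by have := mulr_ge0_le0 (ltW hu) hv; lra.
Qed.

(** If the residual is positive, feasibility of [p] bounds it by [dot i (y - p)]; otherwise both
    sides vanish. *)
Lemma resid_feasible i y p : feas A b p ->
  res i y ^+ 2 <= res i y * dot i (y - p).
Proof.
move=> /(_ i) hp; rewrite dotrB /resid.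
by case: (leP (dot i y - b i) 0) => hu; nra.
Qed.

(** The index chosen at [y] lies in [tau], so its residual at [z] is at most the greedy one at
    [z]. *)
Lemma greedy_subgrad tau y z : #|tau| = beta ->
  res (sel tau y) y ^+ 2 / 2 + res (sel tau y) y * dot (sel tau y) (z - y)
  <= res (sel tau z) z ^+ 2 / 2.
Proof.
move=> card_tau; apply: le_trans (resid_subgrad _ _ _) _.
have [mem_sel _] := sel_greedy y card_tau.
have [_ /(_ _ mem_sel) le_res] := sel_greedy z card_tau.
by rewrite ler_pM2r ?invr_gt0 // ler_sqr ?nnegrE ?resid_ge0.
Qed.

Lemma fobjE y : f y = avg beta (fun tau => res (sel tau y) y ^+ 2 / 2).
Proof. by []. Qed.

Lemma fobj_ge0 y : 0 <= f y.
Proof.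
rewrite -(avg_cst beta_le 0) fobjE; apply: le_avg => // tau _.
by rewrite divr_ge0 ?sqr_ge0.
Qed.

(** Jensen's inequality, by summing over [l] the subgradient inequalities based at the mean [z]. *)
Lemma fobj_mean k (y : nat -> 'rV[R]_n) : (0 < k)%N ->
  k%:R * f (k%:R^-1 *: \sum_(1 <= l < k.+1) y l) <= \sum_(1 <= l < k.+1) f (y l).
Proof.
move=> k_gt0; set z := _ *: _.
pose g tau l := res (sel tau z) z ^+ 2 / 2
  + res (sel tau z) z * dot (sel tau z) (y l - z).
have k_neq0 : k%:R != 0 :> R by rewrite pnatr_eq0 -lt0n.
(* The linear terms cancel because the deviations [y l - z] sum to zero. *)
have sum_g tau : \sum_(1 <= l < k.+1) g tau l = k%:R * (res (sel tau z) z ^+ 2 / 2).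
  rewrite /g big_split /= sumr_const_nat -mulr_sumr.
  have <- := dotr_sum (sel tau z) (index_iota 1 k.+1) (fun l => y l - z).
  rewrite sumrB.
  rewrite sumr_const_nat subn1 /= -scaler_nat /z scalerA divff // scale1r.
  by rewrite subrr -(scale0r 0) dotrZ mul0r mulr0 addr0 mulr_natl.
have -> : \sum_(1 <= l < k.+1) f (y l) =
    avg beta (fun tau => \sum_(1 <= l < k.+1) res (sel tau (y l)) (y l) ^+ 2 / 2).
  by rewrite /avg exchange_big /= mulr_suml.
rewrite fobjE -avgZ; apply: le_avg => // tau card_tau.
by rewrite -sum_g; apply: ler_sum => l _; exact: greedy_subgrad.
Qed.

End Objective.

(** * The PASKM iteration *)

Section Iteration.
Set Implicit Arguments.
Unset Strict Implicit.
Variables (R : realType) (m n : nat) (A : 'M[R]_(m, n)) (b : 'I_m -> R).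
Variables (beta : nat) (sel : {set 'I_m} -> 'rV[R]_n -> 'I_m).
Variables (alpha omega delta gamma : R) (x0 : 'rV[R]_n).
Hypothesis row_norm : forall i : 'I_m, \sum_(j < n) A i j ^+ 2 = 1.
Hypothesis beta_le : (beta <= m)%N.
Hypothesis sel_greedy : greedy_rule A b beta sel.
Hypothesis gammaE : alpha * gamma = alpha * delta + omega * delta * (1 - alpha).
Hypothesis delta_ge0 : 0 <= delta.
Local Notation w := (omega * (1 - alpha)).
Hypothesis w_ge0 : 0 <= w.
Hypothesis w_le1 : w <= 1.
Local Notation c := (2 - 2 * w - 2 * delta * w - delta).
Hypothesis c_ge0 : 0 <= c.
Implicit Types (s : nat -> {set 'I_m}) (p : 'rV[R]_n).

Local Notation dot := (dotr A).
Local Notation res := (resid A b).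
Local Notation f := (fobj A b beta sel).
Local Notation state s l := (pstate A b alpha omega delta gamma sel s x0 l).
Local Notation y s l := (yit A b alpha omega delta gamma sel s x0 l).
Local Notation idx s l := (sel (s l) (y s l)).
Local Notation stepres s l := (res (idx s l) (y s l)).

Definition pivot s l : 'rV[R]_n :=
  (1 - w - alpha) *: (state s l).1 + alpha *: (state s l).2.

Lemma yitE s l : y s l = alpha *: (state s l).2 + (1 - alpha) *: (state s l).1.
Proof. by rewrite /yit; case: (state s l). Qed.

Lemma pstateS s l : state s l.+1 =
  (y s l - (delta * stepres s l) *: row (idx s l) A,
   omega *: (state s l).2 + (1 - omega) *: y s l
     - (gamma * stepres s l) *: row (idx s l) A).
Proof. by rewrite yitE /=; case: (state s l). Qed.

(** The total step along the row is [(1 - w - alpha) delta + alpha gamma], which [gammaE] reduces to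
    [delta]. The rest is [y - w x], which is again the old pivot. *)
Lemma pivotS s l :
  pivot s l.+1 = pivot s l - (delta * stepres s l) *: row (idx s l) A.
Proof.
rewrite /pivot pstateS /=; move: (idx s l) (stepres s l) => i r.
rewrite yitE; apply/rowP => j; rewrite !mxE.
move: ((state s l).1 0 j) ((state s l).2 0 j) (A i j) => x v a.
have gamma0 : (alpha * gamma - (alpha * delta + omega * delta * (1 - alpha)))
    * (r * a) = 0 by rewrite gammaE subrr mul0r.
by apply/eqP; rewrite -subr_eq0 -oppr_eq0 -[X in _ == X]gamma0; apply/eqP; ring.
Qed.

Lemma pivotE s l :
  pivot s l = (1 - w) *: y s l + w *: (y s l - (state s l).1).
Proof. by rewrite /pivot yitE; apply/rowP => j; rewrite !mxE; ring. Qed.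

(** By [pivotE] the cross term splits in two: feasibility bounds the part along [y - p], and the
    momentum part along [y - x] is kept for comparison with the previous step. *)
Lemma sqnorm_pivotS_le s l p : feas A b p ->
  sqnorm (pivot s l.+1 - (1 - w) *: p) <= sqnorm (pivot s l - (1 - w) *: p)
   - 2 * delta * ((1 - w) * stepres s l ^+ 2
                  + w * (stepres s l * dot (idx s l) (y s l - (state s l).1)))
   + delta ^+ 2 * stepres s l ^+ 2.
Proof.
move=> feas_p; rewrite pivotS addrAC sqnorm_sub_row //.
have := resid_feasible (idx s l) (y s l) feas_p.
move: (idx s l) (stepres s l) => i r le_r.
have -> : pivot s l - (1 - w) *: p =
    (1 - w) *: (y s l - p) + w *: (y s l - (state s l).1).
  by rewrite pivotE; apply/rowP => j; rewrite !mxE; ring.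
rewrite [dot i (_ *: _ + _)]dotrD !dotrZ.
have := ler_wpM2l (mulr_ge0 delta_ge0 (_ : 0 <= 1 - w)) le_r.
rewrite subr_ge0 => /(_ w_le1).
move: (sqnorm _) (dot i (y s l - p)) (dot i _) => D P Q; lra.
Qed.

(** Adaptedness: the state at time [l] reads only the samples of index below [l]. *)
Lemma pstate_set_sample s k tau l : (l <= k)%N ->
  state (set_sample s k tau) l = state s l.
Proof.
elim: l => [//|l IHl ltlk]; rewrite !pstateS !yitE IHl ?(ltnW ltlk) //.
by rewrite /set_sample ltn_eqF.
Qed.

Lemma yit_set_sample s k tau l : (l <= k)%N ->
  y (set_sample s k tau) l = y s l.
Proof. by move=> le_lk; rewrite /yit pstate_set_sample. Qed.

Lemma set_sampleE s k tau : set_sample s k tau k = tau.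
Proof. by rewrite /set_sample eqxx. Qed.

(** A function of samples [0] to [k]. Its terms in [f (y s k)] and [stepres s k ^+ 2] pay for the
    momentum term of the next step. *)
Definition potential p s k : R :=
  sqnorm (pivot s k.+1 - (1 - w) *: p) + 2 * delta * w * f (y s k)
  + delta ^+ 2 * w * stepres s k ^+ 2
  + 2 * delta * c * \sum_(1 <= l < k.+1) f (y s l).

Lemma avg_potential0 p s : feas A b p ->
  avg beta (fun tau => potential p (set_sample s 0 tau) 0) <=
  (1 - w) ^+ 2 * sqnorm (x0 - p)
  + 2 * delta * (delta - 2 + 3 * w + delta * w) * f x0.
Proof.
move=> feas_p.
have y0 s' : y s' 0 = x0 by rewrite yitE /= -scalerDl addrCA subrr addr0 scale1r.
apply: (@le_trans _ _ (avg beta (fun tau =>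
    ((1 - w) ^+ 2 * sqnorm (x0 - p) + 2 * delta * w * f x0)
    + (2 * delta ^+ 2 - 4 * delta * (1 - w) + 2 * delta ^+ 2 * w)
      * (res (sel tau x0) x0 ^+ 2 / 2)))).
  apply: le_avg => // tau _; rewrite /potential big_geq // mulr0 addr0.
  have := sqnorm_pivotS_le (set_sample s 0 tau) 0 feas_p.
  rewrite (pivotE _ 0) !y0 set_sampleE.
  have -> : (state (set_sample s 0 tau) 0).1 = x0 by [].
  (* Since [y_0 = x_0], there is no momentum at time 0 and the pivot is [(1 - w) *: x0]. *)
  rewrite (subrr x0) scaler0 addr0.
  rewrite -scalerBr sqnormZ -(scale0r 0) dotrZ.
  move: (sqnorm (_ - _)) (sqnorm _) => D' D; lra.
rewrite avgD avgZ avg_cst // -fobjE; lra.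
Qed.

Lemma avg_potentialS p s k : feas A b p ->
  avg beta (fun tau => potential p (set_sample s k.+1 tau) k.+1)
  <= potential p s k.
Proof.
move=> feas_p; set z := y s k.+1.
(* [K] collects the terms determined by the samples up to index [k]. *)
pose K := sqnorm (pivot s k.+1 - (1 - w) *: p)
  + delta ^+ 2 * w * stepres s k ^+ 2 + 2 * delta * w * f z
  + 2 * delta * c * \sum_(1 <= l < k.+2) f (y s l).
apply: (@le_trans _ _ (avg beta (fun tau => K
    + ((2 * delta ^+ 2 - 4 * delta * (1 - w) - 2 * delta * w
        + 4 * delta ^+ 2 * w) * (res (sel tau z) z ^+ 2 / 2)
    + 2 * delta * w * (res (sel tau (y s k)) (y s k) ^+ 2 / 2))))).
  apply: le_avg => // tau card_tau; rewrite /potential.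
  have := sqnorm_pivotS_le (set_sample s k.+1 tau) k.+1 feas_p.
  have -> : pivot (set_sample s k.+1 tau) k.+1 = pivot s k.+1.
    by rewrite /pivot pstate_set_sample.
  have -> : \sum_(1 <= l < k.+2) f (y (set_sample s k.+1 tau) l) =
      \sum_(1 <= l < k.+2) f (y s l).
    by apply: eq_big_nat => l /andP[_ ltlk]; rewrite yit_set_sample.
  rewrite pstate_set_sample // yit_set_sample // set_sampleE -/z.
  (* As [x_{k+1}] is [y_k] minus a step along a row, the momentum term splits into a product of
     consecutive steps and a subgradient term between [z] and [y_k]. *)
  have -> : dot (sel tau z) (z - (state s k.+1).1) =
      delta * stepres s k * dot (sel tau z) (row (idx s k) A)
      - dot (sel tau z) (y s k - z).
    by rewrite pstateS /= !dotrB dotrZ; ring.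
  have := ler_wpM2l (mulr_ge0 delta_ge0 w_ge0)
    (greedy_subgrad sel_greedy z (y s k) card_tau).
  have := ler_wpM2l (mulr_ge0 delta_ge0 (mulr_ge0 delta_ge0 w_ge0))
    (mul_dot_row_le row_norm (sel tau z) (idx s k) (res (sel tau z) z)
      (stepres s k)).
  rewrite /K; move: (dot _ _) (dot _ (row _ _)) (stepres s k) => P Q r.
  move: (sqnorm _) (sqnorm _) (f z) (\sum_(_ <= _ < _) _) => D D' fz S.
  move: (res _ _) (res _ z) => r2 r1; lra.
(* The terms in [f z] outside the sum total [- 2 * delta * c], exactly cancelling the new summand;
   this dictates the value of [c]. *)
rewrite avgD avg_cst // avgD !avgZ -!fobjE /K /potential big_nat_recr //= -/z; lra.
Qed.

Lemma path_avg_potential_le p k : feas A b p ->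
  path_avg beta k.+1 (fun s => potential p s k) <=
  (1 - w) ^+ 2 * sqnorm (x0 - p)
  + 2 * delta * (delta - 2 + 3 * w + delta * w) * f x0.
Proof.
move=> feas_p; elim: k => [|k IHk].
  by rewrite path_avgS path_avg0; exact: avg_potential0.
rewrite path_avgS; apply: le_trans IHk.
by apply: le_path_avg => s; exact: avg_potentialS.
Qed.

Lemma exp_f_ybar_feasible_le p k : feas A b p -> (0 < k)%N ->
  2 * delta * k%:R * c
    * exp_f_ybar A b alpha omega delta gamma sel beta k x0 <=
  (1 - w) ^+ 2 * sqnorm (x0 - p)
  + 2 * delta * (delta - 2 + 3 * w + delta * w) * f x0.
Proof.
move=> feas_p k_gt0; apply: le_trans (path_avg_potential_le k feas_p).
(* The potential uses [k.+1] samples but [ybar] only the first [k]; averaging over one more sample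
   leaves its expectation unchanged. *)
have -> : exp_f_ybar A b alpha omega delta gamma sel beta k x0 =
    path_avg beta k.+1 (fun s => f (ybar A b alpha omega delta gamma sel s x0 k)).
  rewrite path_avgS; congr (_ / _); apply: eq_bigr => v _.
  rewrite -[LHS](avg_cst beta_le); congr (avg beta _); apply/funext => tau.
  congr (f (_ *: _)); apply: eq_big_nat => l /andP[_ lelk].
  by rewrite yit_set_sample.
rewrite -path_avgZ; apply: le_path_avg => s.
have := fobj_mean beta_le sel_greedy (fun l => y s l) k_gt0.
rewrite -/(ybar A b alpha omega delta gamma sel s x0 k) => Jensen.
have := ler_wpM2l (mulr_ge0 delta_ge0 c_ge0) Jensen.
(* All terms of the potential other than the sum are nonnegative and are dropped. *)
have := sqnorm_ge0 (pivot s k.+1 - (1 - w) *: p).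
have := mulr_ge0 (mulr_ge0 delta_ge0 w_ge0) (fobj_ge0 A b sel beta_le (y s k)).
have := mulr_ge0 (mulr_ge0 (sqr_ge0 delta) w_ge0) (sqr_ge0 (stepres s k)).
rewrite /potential.
move: (f _) (f _) (\sum_(_ <= _ < _) _) (stepres s k) (sqnorm _) => f1 f2 S r D.
lra.
Qed.

End Iteration.

(** * Passing to the distance by an infimum over feasible points *)

Theorem theorem9 (R : realType) (m n : nat) (A : 'M[R]_(m, n)) (b : 'I_m -> R)
  (beta : nat) (sel : {set 'I_m} -> 'rV[R]_n -> 'I_m)
  (alpha omega delta gamma : R) (x0 : 'rV[R]_n) (k : nat) :
  (forall i : 'I_m, \sum_(j < n) A i j ^+ 2 = 1) ->
  (exists x : 'rV[R]_n, forall i, dotr A i x <= b i) ->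
  (0 < beta)%N -> (beta <= m)%N ->
  greedy_rule A b beta sel ->
  0 <= 1 - alpha -> 1 - alpha < 1 ->
  0 <= omega -> omega < 1 ->
  0 < delta ->
  delta < 2 * (1 - omega + alpha * omega) / (1 + 2 * omega - 2 * alpha * omega) ->
  alpha * gamma = alpha * delta + omega * delta * (1 - alpha) ->
  (0 < k)%N ->
  exp_f_ybar A b alpha omega delta gamma sel beta k x0 <=
    ((1 - omega + alpha * omega) ^+ 2 * dist2 A b x0
     + 2 * delta * (delta - 2 + 3 * omega - 3 * alpha * omega + delta * omega
                    - delta * alpha * omega) * fobj A b beta sel x0)
    / (2 * delta * k%:R * (2 - 2 * omega + 2 * alpha * omega - 2 * delta * omega
                           + 2 * delta * alpha * omega - delta)).
Proof.
move=> row_norm [q feas_q] _ beta_le greedy alpha_le1 alpha_gt0 omega_ge0 omega_lt1.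
move=> delta_gt0 delta_lt gammaE k_gt0.
set w := omega * (1 - alpha).
have w_ge0 : 0 <= w by exact: mulr_ge0.
have w_lt1 : w < 1.
  by apply: le_lt_trans omega_lt1; rewrite ler_piMr // ltW.
(* This is the upper bound on [delta], rearranged as [delta (1 + 2 w) < 2 (1 - w)]. *)
have c_gt0 : 0 < 2 - 2 * w - 2 * delta * w - delta.
  move: delta_lt; rewrite ltr_pdivlMr; last by move: w_ge0; rewrite /w; lra.
  rewrite /w; lra.
have -> : 1 - omega + alpha * omega = 1 - w by rewrite /w; ring.
have -> : delta - 2 + 3 * omega - 3 * alpha * omega + delta * omega
    - delta * alpha * omega = delta - 2 + 3 * w + delta * w by rewrite /w; ring.
have -> : 2 - 2 * omega + 2 * alpha * omega - 2 * delta * omega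
    + 2 * delta * alpha * omega - delta = 2 - 2 * w - 2 * delta * w - delta.
  by rewrite /w; ring.
rewrite ler_pdivlMr ?mulr_gt0 ?ltr0n // -lerBlDr.
have w2_gt0 : 0 < (1 - w) ^+ 2 by rewrite exprn_gt0 // subr_gt0.
(* With [dist2] isolated, it suffices to bound [sqnorm (x0 - p)] below for every feasible [p]; the
   point [q] shows that the set is nonempty. *)
rewrite mulrC -ler_pdivrMl //; apply: lb_le_inf.
  by exists (sqnorm (x0 - q)), q.
move=> _ [p feas_p <-]; rewrite ler_pdivrMl // lerBlDr.
exact: exp_f_ybar_feasible_le (ltW delta_gt0) w_ge0 (ltW w_lt1) (ltW c_gt0) _ _ _ _.
Qed.
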